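(* Let $K$ be the one-point compactification of a discrete space $\Gamma$, let $\delta>0$, and let a $\delta$-$\prec$-chain $F\subset C(K)$ be given. Then there are ordinals $\alpha,\beta\leqslant\omega$ such that the order type of $F$ (ordered by $\prec$) is $\alpha+\beta^\ast$.
   Context: For an order type $\alpha$, $\alpha^\ast$ denotes the reverse order type of $\alpha$. $C(K)$ is the Banach space of all scalar-valued (real or complex) continuous functions on $K$ with the supremum norm. The support $\mathrm{supp}(f)$ of $f\in C(K)$ is the closure of $\{x\in K\colon f(x)\neq 0\}$. For $f,g\in C(K)$ write $f\prec g$ if $f\neq g$ and $f(x)=g(x)$ for every $x\in\mathrm{supp}(f)$; this is a strict (partial) ordering on $C(K)$. A $\prec$-chain is a subset of $C(K)$ any two distinct elements of which are comparable under $\prec$. For $\delta>0$, a $\delta$-$\prec$-chain is a $\prec$-chain $F$ with $\sup_{f\in F}\|f\|<\infty$ and $\|f-g\|\geqslant\delta$ for all distinct $f,g\in F$. *)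

(* Defs.v *)
From HB Require Import structures.
From mathcomp Require Import all_boot all_order all_algebra.
From mathcomp Require Import complex.
From mathcomp Require Import all_classical all_reals ereal topology normedtype.
From mathcomp Require Import wochoice.

Set Implicit Arguments.
Unset Strict Implicit.
Unset Printing Implicit Defensive.

Import Order.TTheory GRing.Theory Num.Theory.
Import numFieldTopology.Exports.

Local Open Scope classical_set_scope.
Local Open Scope ring_scope.

Variant scalar_kind := RealScalars | ComplexScalars.

Definition scalar_field (R : realType) (k : scalar_kind) : numFieldType :=
  match k with
  | RealScalars => R
  | ComplexScalars => (R[i])%C
  end.

(* In [R[i]] the norm [`|z|] is itself an element of [R[i]] (with zero
   imaginary part), hence the real part. *)
Definition modulus (R : realType) (k : scalar_kind) : scalar_field R k -> R :=
  match k with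
  | RealScalars => fun x : R => `|x|
  | ComplexScalars => fun z : (R[i])%C => complex.Re `|z|
  end.

Section ContinuousFunctions.
Context (R : realType) (k : scalar_kind) (K : topologicalType).

Local Notation CK := (continuousType K (scalar_field R k)).

Implicit Types (f g : CK) (F : set CK).

(* [sup] is a genuine supremum only for a nonempty set bounded above, which is
   the case here as soon as [K] is compact and nonempty and [h] is continuous. *)
Definition supnorm (h : K -> scalar_field R k) : R :=
  sup [set modulus (h x) | x in [set: K]].

Definition supp f : set K := closure [set x | f x != 0].

Definition prec f g : Prop := f <> g /\ forall x, supp f x -> f x = g x.

Definition prec_chain F : Prop :=
  forall f g, F f -> F g -> f <> g -> prec f g \/ prec g f.

Definition delta_prec_chain (delta : R) F : Prop :=
  [/\ prec_chain F,
      (ereal_sup [set (supnorm f)%:E | f in F] < +oo)%E &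
      forall f g, F f -> F g -> f <> g -> delta <= supnorm (f \- g)].

(* The order of [F], as a non-strict relation (as in [well_order]). *)
Definition chain_order F : rel (set_type F) :=
  fun u v => `[< set_val u = set_val v \/ prec (set_val u) (set_val v) >].

End ContinuousFunctions.

(* Linear order types are handled through representatives: a type with a
   non-strict order relation, compared up to order isomorphism. *)
Definition same_order_type (T U : Type) (r : rel T) (s : rel U) : Prop :=
  exists2 phi : T -> U, bijective phi & {mono phi : x y / r x y >-> s x y}.

Definition reverse_order (T : Type) (r : rel T) : rel T := fun x y => r y x.

Definition sum_order (T U : Type) (r : rel T) (s : rel U) : rel (T + U) :=
  fun a b => match a, b with
             | inl x, inl y => r x y
             | inl _, inr _ => true
             | inr _, inl _ => false
             | inr x, inr y => s x y
             end.

(* An ordinal, represented by a well-ordered type having that order type. *)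
Record ordinal_rep := OrdinalRep {
  ord_carrier :> Type;
  ord_rel : rel ord_carrier;
  ord_wo : well_order ord_rel
}.

(* [alpha <= beta] for ordinals: [alpha] is isomorphic to an initial segment
   of [beta], possibly all of it. *)
Definition ordinal_le (alpha beta : ordinal_rep) : Prop :=
  exists2 phi : alpha -> beta,
    {mono phi : x y / ord_rel x y >-> ord_rel x y} &
    forall x b, ord_rel b (phi x) -> exists y, phi y = b.

Lemma leq_well_order : well_order leq.
Proof.
apply: antisymmetric_well_order; first exact: anti_leq.
move=> A exA; case: (ex_minnP exA) => m Am m_min.
by exists m; split=> // n; exact: m_min.
Qed.

Definition omega : ordinal_rep := OrdinalRep leq_well_order.

(* Main.v *)
Require Import Defs.
From HB Require Import structures.
From mathcomp Require Import all_boot all_order all_algebra.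
From mathcomp Require Import finmap complex.
From mathcomp Require Import all_classical all_reals ereal topology normedtype.
From mathcomp Require Import wochoice.

Set Implicit Arguments.
Unset Strict Implicit.
Unset Printing Implicit Defensive.

Import Order.TTheory GRing.Theory Num.Theory.
Import numFieldTopology.Exports.

Local Open Scope classical_set_scope.
Local Open Scope ring_scope.

(** Write oo for the point at infinity [None]. Going up along [prec], a function
    keeps its nonzero values and only acquires new ones on its zero set. So, if
    [f oo] is nonzero, the same holds for every successor of [f], and the chain
    splits into a lower part, where [f oo = 0], followed by an upper part, where
    [f oo <> 0]. As a compact set of a discrete space is finite, every
    neighbourhood of oo is cofinite ([finite_setC_nbhs_infty]), and the members
    of each part can be ranked by the size of a finite set.

    - In the lower part, [f] is small near oo, so that the set of points where
      [f] has modulus at least [delta / 2] is finite. It grows strictly along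
      the chain: two members differ by more than [delta / 2] at some point, and
      there the smaller one vanishes ([card_large_ltn]). Its cardinality is a
      strictly increasing map to the natural numbers.
    - In the upper part, [f] is nonzero near oo, so that its zero set is finite.
      It shrinks strictly along the chain ([card_zeros_ltn]), and its
      cardinality is a strictly decreasing map to the natural numbers.

    A linear order with a strictly increasing map to the natural numbers has an
    order type at most omega, and one with a strictly decreasing map has the
    reverse of such a type; [order_type_of_two_sided_rank] assembles the two
    parts. *)

(** * Linear orders ranked by natural numbers *)

Lemma injective_nat_well_order (T : Type) (rho : T -> nat) :
  injective rho -> well_order (fun x y => rho x <= rho y)%N.
Proof.
move=> rho_inj; apply: antisymmetric_well_order.
  by move=> x y /anti_leq /rho_inj.
move=> A [x0 Ax0].
have ex_rank : exists n, `[< exists2 x, x \in A & rho x = n >].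
  by exists (rho x0); apply/asboolP; exists x0.
case: (ex_minnP ex_rank) => m /asboolP[x Ax <-] x_min.
by exists x; split=> // y Ay; apply: x_min; apply/asboolP; exists y.
Qed.

(** The number of elements of [S] below [i] goes up by at most one when [i] does,
    so it takes every intermediate value, and it leaves a value exactly at an
    element of [S]. *)
Lemma count_below_surjective (S : pred nat) (n m : nat) :
  (m < count S (iota 0 n))%N ->
  exists2 i, S i & count S (iota 0 i) = m.
Proof.
elim: n => [//|n IHn]; rewrite -{1}(addn1 n) iotaD count_cat add0n /= addn0.
case Sn: (S n); rewrite ?addn1 ?addn0 // ltnS leq_eqVlt.
by case/orP=> [/eqP->|/IHn //]; exists n.
Qed.

(** The ranks may leave gaps; counting the ranks that lie below the rank of [x]
    closes them, which gives an isomorphism onto an initial segment. *)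
Lemma rank_ordinal_le_omega (T : Type) (rho : T -> nat)
    (rho_inj : injective rho) :
  ordinal_le (OrdinalRep (injective_nat_well_order rho_inj)) omega.
Proof.
pose S n := `[< exists x, rho x = n >].
pose phi x := count S (iota 0 (rho x)).
have S_rho x : S (rho x) by apply/asboolP; exists x.
have phi_lt x y : (rho x < rho y)%N -> (phi x < phi y)%N.
  move=> ltxy; rewrite /phi -(subnKC ltxy) iotaD count_cat.
  rewrite -(addn1 (rho x)) iotaD count_cat /= add0n S_rho addn0 addn1.
  by rewrite -addnA -[X in (X < _)%N]addn0 ltn_add2l.
exists phi => [x y|x b] /=.
  case: (ltngtP (rho x) (rho y)) => [/phi_lt/ltnW //|/phi_lt|eqxy].
    by rewrite ltnNge => /negbTE.
  by rewrite /phi eqxy leqnn.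
rewrite leq_eqVlt => /orP[/eqP->|]; first by exists x.
by case/count_below_surjective => _ /asboolP[y <-] <-; exists y.
Qed.

(** A cut of a linear order into a lower part [P], on which [rho] increases
    strictly, and an upper part, on which it decreases strictly, exhibits the
    order as a sum: each part is isomorphic to the order induced by its ranks,
    reversed for the upper part. *)
Lemma order_type_of_two_sided_rank (T : Type) (r : rel T) (P : pred T)
    (rho : T -> nat) :
  total r ->
  (forall x y, r x y -> P y -> P x) ->
  (forall x y, P x -> P y -> r x y -> x <> y -> (rho x < rho y)%N) ->
  (forall x y, ~~ P x -> ~~ P y -> r x y -> x <> y -> (rho y < rho x)%N) ->
  exists alpha beta : ordinal_rep,
    [/\ ordinal_le alpha omega,
        ordinal_le beta omega &
        same_order_type r
          (sum_order (@ord_rel alpha) (reverse_order (@ord_rel beta)))].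
Proof.
move=> r_total lowP rank_up rank_down.
have r_refl x : r x x by case/orP: (r_total x x).
have up_mono x y : P x -> P y -> r x y = (rho x <= rho y)%N.
  move=> Px Py; have [->|nxy] := pselect (x = y); first by rewrite r_refl leqnn.
  case rxy: (r x y); first by rewrite ltnW // rank_up.
  have ryx : r y x by move: (r_total x y); rewrite rxy.
  by apply/esym/negbTE; rewrite -ltnNge rank_up // => /esym.
have down_mono x y : ~~ P x -> ~~ P y -> r x y = (rho y <= rho x)%N.
  move=> Px Py; have [->|nxy] := pselect (x = y); first by rewrite r_refl leqnn.
  case rxy: (r x y); first by rewrite ltnW // rank_down.
  have ryx : r y x by move: (r_total x y); rewrite rxy.
  by apply/esym/negbTE; rewrite -ltnNge rank_down // => /esym.
have up_inj : injective (fun u : {x | P x} => rho (val u)).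
  move=> [x Px] [y Py] /= eqr; apply: val_inj => /=.
  have [//|nxy] := pselect (x = y).
  by have := rank_up x y Px Py; rewrite up_mono // eqr leqnn ltnn => /(_ isT nxy).
have down_inj : injective (fun u : {x | ~~ P x} => rho (val u)).
  move=> [x Px] [y Py] /= eqr; apply: val_inj => /=.
  have [//|nxy] := pselect (x = y).
  have := rank_down x y Px Py.
  by rewrite down_mono // eqr leqnn ltnn => /(_ isT nxy).
exists (OrdinalRep (injective_nat_well_order up_inj)).
exists (OrdinalRep (injective_nat_well_order down_inj)).
split; [exact: rank_ordinal_le_omega | exact: rank_ordinal_le_omega |].
pose psi (u : {x | P x} + {x | ~~ P x}) :=
  match u with inl v => val v | inr v => val v end.
have psi_surj x : {u | psi u = x}.
  by case: (boolP (P x)) => Px;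
    [exists (inl (exist _ x Px)) | exists (inr (exist _ x Px))].
have psi_inj : injective psi.
  move=> [[a Pa]|[a Pa]] [[b Pb]|[b Pb]] /= eqab.
  - by congr inl; exact: val_inj.
  - by exfalso; rewrite -eqab Pa in Pb.
  - by exfalso; rewrite eqab Pb in Pa.
  - by congr inr; exact: val_inj.
pose phi x := sval (psi_surj x).
have psiE x : psi (phi x) = x by exact: (svalP (psi_surj x)).
have phiE u : phi (psi u) = u by apply: psi_inj.
exists phi; first by exists psi.
move=> x y; rewrite -{2}[x]psiE -{2}[y]psiE.
case: (phi x) (phi y) => [[a Pa]|[a Pa]] [[b Pb]|[b Pb]] /=.
- by rewrite up_mono.
- apply/esym; case/orP: (r_total a b) => // /lowP/(_ Pa) Pb'.
  by rewrite Pb' in Pb.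
- by apply/esym/negbTE/negP => /lowP/(_ Pb) Pa'; rewrite Pa' in Pa.
- by rewrite down_mono.
Qed.

(** * Neighbourhoods of the point at infinity *)

(** Let [E] grow along the sets that contain a given finite set. As [X] is
    discrete, each point has a neighbourhood, itself, that eventually lies in
    [E]; compactness makes this uniform, so that some finite set contains [A]. *)
Lemma discrete_compact_finite (X : discreteTopologicalType) (A : set X) :
  compact A -> finite_set A.
Proof.
move/compact_near_coveringP.
move=> /(_ (set X) (filter_from finite_set (fun D => [set E | D `<=` E]))
  (fun E x => E x)).
case.
- apply: filter_from_filter; first by exists set0; exact: finite_set0.
  move=> D E finD finE; exists (D `|` E); first by rewrite finite_setU.
  by move=> S /=; rewrite subUset.
- move=> x _; exists ([set x], [set E | [set x] `<=` E]) => /=.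
    by split; [exact: discrete_set1 | exists [set x]].
  by move=> [y E] /= [-> xE]; exact: xE.
- by move=> D finD AD; apply: (sub_finite_set _ finD); apply: AD => /=.
Qed.

Lemma finite_setC_nbhs_infty (X : discreteTopologicalType)
    (U : set (one_point_compactification X)) :
  nbhs (None : one_point_compactification X) U -> finite_set (~` U).
Proof.
case=> A [/discrete_compact_finite finA _] AU.
apply: (sub_finite_set _ (finite_image Some finA)) => -[x|] nUx.
  by exists x => //; apply: contrapT => nAx; apply: nUx; apply: AU; left; exists x.
by case: nUx; apply: AU; right.
Qed.

Lemma finite_preimage_setC (X : discreteTopologicalType) (T : topologicalType)
    (f : continuousType (one_point_compactification X) T) (A : set T) :
  nbhs (f None) A -> finite_set [set x | ~ A (f x)].
Proof.
move=> fA; apply: (@finite_setC_nbhs_infty X (f @^-1` A)).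
exact: (cts_fun (s := f) None _ fA).
Qed.

(** * Scalars and their modulus *)

Lemma nbhs0_norm_lt (L : numFieldType) (e : L) :
  0 < e -> nbhs (0 : L) [set z | `|z| < e].
Proof.
move=> e0; apply/nbhs_ballP; exists e => // z.
by rewrite /ball /= sub0r normrN.
Qed.

Lemma nbhs_neq0 (L : numFieldType) (a : L) :
  a != 0 -> nbhs a [set z | z != 0].
Proof.
move=> a0; apply/nbhs_ballP; exists `|a|; first by rewrite /= normr_gt0.
move=> z; rewrite /ball /=; apply: contraTneq => ->.
by rewrite subr0 ltxx.
Qed.

Lemma nbhs0_modulus_lt (R : realType) (k : scalar_kind) (e : R) :
  0 < e -> nbhs (0 : scalar_field R k) [set z | modulus z < e].
Proof.
move=> e0.
have [eps eps0 epsP] : exists2 eps : scalar_field R k, 0 < eps &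
    forall z : scalar_field R k, `|z| < eps -> modulus z < e.
  case: k; first by exists e.
  exists (e%:C)%C => [|z]; first by rewrite ltcR.
  (* [scalar_field R ComplexScalars] hides the head [R[i]] that the lemmas on
     complex numbers look for. *)
  change (`|z : R[i]%C| < (e%:C)%C -> complex.Re `|z : R[i]%C| < e).
  by rewrite normc_def ltcR.
by apply: filterS (nbhs0_norm_lt eps0) => z; exact: epsP.
Qed.

Lemma modulus0 (R : realType) (k : scalar_kind) :
  modulus (0 : scalar_field R k) = 0.
Proof.
case: k; first exact: normr0.
by change (complex.Re `|0 : R[i]%C| = 0); rewrite normr0.
Qed.

(** * Strict growth along a chain *)

Lemma card_fset_set_ltn (T : choiceType) (A B : set T) :
  finite_set B -> A `<=` B -> (exists2 x, B x & ~ A x) ->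
  (#|` fset_set A| < #|` fset_set B|)%N.
Proof.
move=> finB AB [x Bx nAx]; have finA := sub_finite_set AB finB.
apply/fproper_ltn_card/andP; split; first by rewrite -fset_set_sub.
by apply/negP; rewrite -fset_set_sub // => /(_ x Bx).
Qed.

Section Prec.
Context (R : realType) (k : scalar_kind).

Lemma supnorm_gt (K : topologicalType) (h : K -> scalar_field R k) (e : R)
    (x0 : K) :
  e < supnorm h -> exists x, e < modulus (h x).
Proof.
case/sup_gt; first by exists (modulus (h x0)), x0.
by move=> _ [x _ <-] ehx; exists x.
Qed.

Lemma prec_eq (K : topologicalType)
    (f g : continuousType K (scalar_field R k)) (x : K) :
  prec f g -> f x != 0 -> g x = f x.
Proof. by move=> [_ fg] fx; rewrite fg //; exact: subset_closure. Qed.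

Lemma prec_new_nonzero (K : topologicalType)
    (f g : continuousType K (scalar_field R k)) :
  prec f g -> exists2 x, f x = 0 & g x != 0.
Proof.
move=> fg; apply: contrapT => nex; case: (fg) => + _; apply.
apply/continuousEP => x; case: (eqVneq (f x) 0) => [fx|/(prec_eq fg)//].
by case: (eqVneq (g x) 0) => [->//|gx]; case: nex; exists x.
Qed.

Context (Gamma : discreteTopologicalType).
Local Notation K := (one_point_compactification Gamma).
Implicit Types f g : continuousType K (scalar_field R k).

Lemma card_large_ltn (delta : R) f g :
  0 < delta -> prec f g -> g None = 0 -> delta <= supnorm (g \- f) ->
  (#|` fset_set [set x | (delta / 2 <= modulus (f x))%R]| <
   #|` fset_set [set x | (delta / 2 <= modulus (g x))%R]|)%N.
Proof.
move=> delta0 fg g0 gf_delta.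
have half0 : 0 < delta / 2 by rewrite divr_gt0.
have large_neq0 x : delta / 2 <= modulus (f x) -> f x != 0.
  by apply: contraTneq => ->; rewrite modulus0 -ltNge.
apply: card_fset_set_ltn.
- apply: (sub_finite_set _ (@finite_preimage_setC _ _ g
    [set z | modulus z < delta / 2] _)).
    by move=> x /=; rewrite leNgt => /negP.
  by rewrite g0; exact: nbhs0_modulus_lt.
- by move=> x /= fx; rewrite (prec_eq fg) //; exact: large_neq0.
(* Halving [delta] makes the inequality below the supremum strict, so that some
   point realizes it. *)
- have [|x] := @supnorm_gt _ (g \- f) (delta / 2) None.
    by apply: lt_le_trans gf_delta; rewrite ltr_pdivrMr // ltr_pMr // ltr1n.
  case: (eqVneq (f x) 0) => [fx0|fx].
    rewrite /= fx0 subr0 => gx; exists x; first exact: ltW.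
    by move/large_neq0; rewrite fx0 eqxx.
  by rewrite /= (prec_eq fg fx) subrr modulus0 ltNge (ltW half0).
Qed.

Lemma card_zeros_ltn f g :
  prec f g -> f None != 0 ->
  (#|` fset_set [set x | g x = 0%R]| < #|` fset_set [set x | f x = 0%R]|)%N.
Proof.
move=> fg f0; apply: card_fset_set_ltn.
- apply: (sub_finite_set _ (finite_preimage_setC (nbhs_neq0 f0))).
  by move=> x /= ->; rewrite eqxx.
- move=> x /= gx; apply: contrapT => /eqP fx; move: (fx).
  by rewrite -(prec_eq fg fx) gx eqxx.
- by have [x fx gx] := prec_new_nonzero fg; exists x => //; exact/eqP.
Qed.

End Prec.

Theorem proposition3p3 (R : realType) (k : scalar_kind)
    (Gamma : discreteTopologicalType) (delta : R)
    (F : set (continuousType (one_point_compactification Gamma)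
                             (scalar_field R k))) :
  0 < delta ->
  delta_prec_chain delta F ->
  exists alpha beta : ordinal_rep,
    [/\ ordinal_le alpha omega,
        ordinal_le beta omega &
        same_order_type (@chain_order R k _ F)
          (sum_order (@ord_rel alpha) (reverse_order (@ord_rel beta)))].
Proof.
move=> delta0 [chainF _ sepF].
have memF (u : F) : F (val u) by exact: set_mem (valP u).
have chain_prec (u v : F) : chain_order u v -> u <> v -> prec (val u) (val v).
  by move=> /asboolP[/val_inj|].
pose vanishes (u : F) := val u None == 0.
pose rank (u : F) := if vanishes u
  then #|` fset_set [set x | delta / 2 <= modulus (val u x)]|
  else #|` fset_set [set x | val u x = 0]|.
apply: (@order_type_of_two_sided_rank _ _ vanishes rank).
- move=> u v; have [uv|nuv] := pselect (val u = val v).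
    by apply/orP; left; apply/asboolP; left.
  by apply/orP; case: (chainF _ _ (memF u) (memF v) nuv) => uv;
    [left|right]; apply/asboolP; right.
- move=> u v /asboolP[/val_inj->//|uv]; apply: contraTT => u0.
  by rewrite /vanishes (prec_eq uv u0).
- move=> u v u0 v0 /chain_prec uvP nuv; rewrite /rank u0 v0.
  apply: card_large_ltn => //; [exact: uvP | exact/eqP |].
  by apply: sepF (memF v) (memF u) _ => /val_inj /esym.
- move=> u v u0 v0 /chain_prec uvP nuv.
  rewrite /rank (negbTE u0) (negbTE v0).
  exact: card_zeros_ltn (uvP nuv) u0.
Qed.
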